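(* Let $r>0$ be constant, and consider the tubular hypersurfaces $\mathfrak{T}^{\{j;\lambda\}}(s,t,w)=\beta(s)+r\,U^{\{j;\lambda\}}(s,t,w)$ in $E_1^4$ for $(j;\lambda)\in\{(1;1),(2;1),(2;-1),(3;1),(3;-1),(4;1),(4;-1)\}$, where $$\begin{aligned} U^{\{1;1\}}&=\cos t\cos w\,F_2+\sin t\cos w\,F_3+\sin w\,F_4,\\ U^{\{2;1\}}&=\cosh t\sinh w\,F_2+\cosh w\,F_3+\sinh t\sinh w\,F_4,\\ U^{\{2;-1\}}&=\cosh t\cosh w\,F_2+\sinh w\,F_3+\sinh t\cosh w\,F_4,\\ U^{\{3;1\}}&=\sinh t\sinh w\,F_2+\cosh t\sinh w\,F_3+\cosh w\,F_4,\\ U^{\{3;-1\}}&=\sinh t\cosh w\,F_2+\cosh t\cosh w\,F_3+\sinh w\,F_4,\\ U^{\{4;1\}}&=\cosh w\,F_2+\sinh t\sinh w\,F_3+\cosh t\sinh w\,F_4,\\ U^{\{4;-1\}}&=\sinh w\,F_2+\sinh t\cosh w\,F_3+\cosh t\cosh w\,F_4. \end{aligned}$$ Their Gaussian curvatures $K^{\{j;\lambda\}}$ and mean curvatures $H^{\{j;\lambda\}}$ are $$\begin{aligned} K^{\{1;1\}}&=\frac{k_1\cos t\cos w}{r^2(1+rk_1\cos t\cos w)},& H^{\{1;1\}}&=\frac{2+3rk_1\cos t\cos w}{3r(1+rk_1\cos t\cos w)};\\ K^{\{2;1\}}&=\frac{k_1\cosh t\sinh w}{r^2(1+rk_1\cosh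 t\sinh w)},& H^{\{2;1\}}&=\frac{2+3rk_1\cosh t\sinh w}{3r(1+rk_1\cosh t\sinh w)};\\ K^{\{2;-1\}}&=\frac{k_1\cosh t\cosh w}{r^2(1+rk_1\cosh t\cosh w)},& H^{\{2;-1\}}&=\frac{2+3rk_1\cosh t\cosh w}{3r(1+rk_1\cosh t\cosh w)};\\ K^{\{3;1\}}&=\frac{k_1\sinh t\sinh w}{r^2(1-rk_1\sinh t\sinh w)},& H^{\{3;1\}}&=\frac{2-3rk_1\sinh t\sinh w}{3r(-1+rk_1\sinh t\sinh w)};\\ K^{\{3;-1\}}&=\frac{k_1\sinh t\cosh w}{r^2(-1+rk_1\sinh t\cosh w)},& H^{\{3;-1\}}&=\frac{2-3rk_1\sinh t\cosh w}{3r(1-rk_1\sinh t\cosh w)};\\ K^{\{4;1\}}&=\frac{k_1\cosh w}{r^2(1-rk_1\cosh w)},& H^{\{4;1\}}&=\frac{2-3rk_1\cosh w}{3r(-1+rk_1\cosh w)};\\ K^{\{4;-1\}}&=\frac{k_1\sinh w}{r^2(1-rk_1\sinh w)},& H^{\{4;-1\}}&=\frac{2-3rk_1\sinh w}{3r(-1+rk_1\sinh w)}. \end{aligned}$$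
   Context: $E_1^4$ is $\mathbb{R}^4$ with the inner product $g(x,y)=\langle x,y\rangle=-x_1y_1+x_2y_2+x_3y_3+x_4y_4$. For given $j$, $\beta:I\to E_1^4$ ($I$ an open interval) is a smooth unit-speed curve with smooth Frenet frame $F_1=\beta',F_2,F_3,F_4$, pairwise orthogonal, $g(F_i,F_i)=\varepsilon_i$, where $\varepsilon_j=-1$ and $\varepsilon_i=1$ for $i\neq j$. The Frenet equations are $$F_1'=k_1F_2,\quad F_2'=\varepsilon_3\varepsilon_4k_1F_1+k_2F_3,\quad F_3'=\varepsilon_1\varepsilon_4k_2F_2+k_3F_4,\quad F_4'=\varepsilon_1\varepsilon_2k_3F_3,$$ with smooth functions $k_1,k_2,k_3$ on $I$. The unit normal of $\mathfrak{T}^{\{j;\lambda\}}$ is taken to be $N=-\varepsilon_3\varepsilon_4\lambda^{j}\,U^{\{j;\lambda\}}$. For a parametrized hypersurface $\Gamma(u_1,u_2,u_3)$ with unit normal field $N$: $g_{ik}=\langle\Gamma_{u_i},\Gamma_{u_k}\rangle$, $h_{ik}=\langle\Gamma_{u_iu_k},N\rangle$, $S=[g_{ik}]^{-1}[h_{ik}]$, $K=\det[h_{ik}]/\det[g_{ik}]$, $H=\frac13\operatorname{tr}(S)$. Here $(u_1,u_2,u_3)=(s,t,w)$, and everything is considered at regular points (where $\det[g_{ik}]\neq0$). *)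

(* Defs.v *)
From HB Require Import structures.
From mathcomp Require Import all_boot all_order all_algebra.
From mathcomp Require Import all_classical all_reals all_analysis.

Set Implicit Arguments.
Unset Strict Implicit.
Unset Printing Implicit Defensive.

Import Order.TTheory GRing.Theory Num.Theory.
Import numFieldNormedType.Exports.

Local Open Scope classical_set_scope.
Local Open Scope ring_scope.

Definition cosh (R : realType) (x : R) : R := (expR x + expR (- x)) / 2.
Definition sinh (R : realType) (x : R) : R := (expR x - expR (- x)) / 2.

(* The Minkowski product of E_1^4; coordinate 0 is the timelike one. *)
Definition lorentz (R : realType) (x y : 'rV[R]_4) : R :=
  - (x 0 0 * y 0 0) + x 0 1 * y 0 1 + x 0 2 * y 0 2 + x 0 3 * y 0 3.

Definition smooth_on (R : realType) (V : normedModType R) (I : set R)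
    (f : R -> V) : Prop :=
  forall n s, I s -> derivable (derive1n n f) s 1.

Definition eps (R : realType) (j i : nat) : R := if i == j then -1 else 1.

(* The frame vectors are F 1, ..., F 4 as in the literature; the values of F
   at other indices are irrelevant. *)
Record frenet_curve (R : realType) (j : nat) (I : set R) (beta : R -> 'rV[R]_4)
    (F : nat -> R -> 'rV[R]_4) (k1 k2 k3 : R -> R) : Prop := FrenetCurve {
  frenet_beta_smooth : smooth_on I beta ;
  frenet_frame_smooth : forall i, (1 <= i <= 4)%N -> smooth_on I (F i) ;
  frenet_k1_smooth : smooth_on I k1 ;
  frenet_k2_smooth : smooth_on I k2 ;
  frenet_k3_smooth : smooth_on I k3 ;
  frenet_tangent : forall s, I s -> F 1%N s = derive1 beta s ;
  frenet_orthogonal : forall i l s, (1 <= i <= 4)%N -> (1 <= l <= 4)%N ->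
    i != l -> I s -> lorentz (F i s) (F l s) = 0 ;
  frenet_norm : forall i s, (1 <= i <= 4)%N -> I s ->
    lorentz (F i s) (F i s) = eps R j i ;
  frenet_eq1 : forall s, I s -> derive1 (F 1%N) s = k1 s *: F 2%N s ;
  frenet_eq2 : forall s, I s -> derive1 (F 2%N) s =
    (eps R j 3%N * eps R j 4%N * k1 s) *: F 1%N s + k2 s *: F 3%N s ;
  frenet_eq3 : forall s, I s -> derive1 (F 3%N) s =
    (eps R j 1%N * eps R j 4%N * k2 s) *: F 2%N s + k3 s *: F 4%N s ;
  frenet_eq4 : forall s, I s -> derive1 (F 4%N) s =
    (eps R j 1%N * eps R j 2%N * k3 s) *: F 3%N s }.

Section hypersurface.
Context (R : realType).
Implicit Types (G N : 'rV[R]_3 -> 'rV[R]_4) (u : 'rV[R]_3).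

Definition param (s t w : R) : 'rV[R]_3 := \row_(i < 3) [:: s; t; w]`_i.

Definition partial (i : 'I_3) G : 'rV[R]_3 -> 'rV[R]_4 :=
  fun u => 'D_(delta_mx 0 i : 'rV[R]_3) G u.

Definition first_form G u : 'M[R]_3 :=
  \matrix_(i, l) lorentz (partial i G u) (partial l G u).

Definition second_form G N u : 'M[R]_3 :=
  \matrix_(i, l) lorentz (partial l (partial i G) u) (N u).

Definition regular_point G u : Prop := \det (first_form G u) != 0.

Definition shape_operator G N u : 'M[R]_3 :=
  invmx (first_form G u) *m second_form G N u.

Definition gauss_curvature G N u : R :=
  \det (second_form G N u) / \det (first_form G u).

Definition mean_curvature G N u : R := 3^-1 * \tr (shape_operator G N u).

End hypersurface.

(* Components of U^{j;lam} along F_2, F_3, F_4. Only (1;1) and (j;1), (j;-1)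
   for j = 2, 3, 4 are meaningful; other pairs get an arbitrary value. *)
Definition tube_coef (R : realType) (j : nat) (lam : int) (t w : R) :
    R * R * R :=
  match j with
  | 1%N => (cos t * cos w, sin t * cos w, sin w)
  | 2%N => if lam == 1 then (cosh t * sinh w, cosh w, sinh t * sinh w)
           else (cosh t * cosh w, sinh w, sinh t * cosh w)
  | 3%N => if lam == 1 then (sinh t * sinh w, cosh t * sinh w, cosh w)
           else (sinh t * cosh w, cosh t * cosh w, sinh w)
  | 4%N => if lam == 1 then (cosh w, sinh t * sinh w, cosh t * sinh w)
           else (sinh w, sinh t * cosh w, cosh t * cosh w)
  | _ => (0, 0, 0)
  end.

Section tube.
Context (R : realType) (F : nat -> R -> 'rV[R]_4) (j : nat) (lam : int).

Definition tube_dir (u : 'rV[R]_3) : 'rV[R]_4 :=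
  let: (a, b, c) := tube_coef j lam (u 0 1) (u 0 2) in
  a *: F 2%N (u 0 0) + b *: F 3%N (u 0 0) + c *: F 4%N (u 0 0).

Definition tube (r : R) (beta : R -> 'rV[R]_4) (u : 'rV[R]_3) : 'rV[R]_4 :=
  beta (u 0 0) + r *: tube_dir u.

Definition tube_normal (u : 'rV[R]_3) : 'rV[R]_4 :=
  (- (eps R j 3%N * eps R j 4%N * lam%:~R ^+ j)) *: tube_dir u.

End tube.

(* Main.v *)
Require Import Defs.
From HB Require Import structures.
From mathcomp Require Import all_boot all_order all_algebra.
From mathcomp Require Import ring lra.
From mathcomp Require Import all_classical all_reals all_analysis.

Import Order.TTheory GRing.Theory Num.Theory.
Import numFieldNormedType.Exports.

Local Open Scope classical_set_scope.
Local Open Scope ring_scope.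

(** Why the formulas hold. Let [G = beta + r U] be the tube, [N = - sigma U]
its normal with [sigma = +1] or [-1], and [T = F_1] the tangent of the curve.
The direction [U] has constant square [lam] and is orthogonal to [T], so
differentiating these two relations gives, for the partial derivatives
[G_i = delta_i0 T + r U_i],
  [<G_i, U> = 0]   and   [<G_i, T> = delta_i0 eps_1 q],
where [q = 1 - eps_1 eps_2 r k_1 a] and [a] is the component of [U] along
[F_2]. The curvature [k_1] comes from [<U_s, T> = - <U, T'>] and [T' = k_1 F_2].

Since [N_l = - sigma U_l = - (sigma / r) (G_l - delta_l0 T)], the Weingarten
relation [h_il = - <G_i, N_l>] says that, with [kappa = sigma / r], the second
form is [kappa] times the first form up to a defect supported on the first
column. At a regular point the [G_i] span the orthogonal complement of [U],
hence [T = sum_i x_i G_i] for some row [x]. The coordinates of [T] against the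
[G_l] show that the defect is [e_0^T x g], so the shape operator is conjugate
to [kappa (1 - e_0^T x)], and [<T, T> = eps_1] forces [x_0 q = 1]. Therefore
  [K = kappa^3 (1 - 1/q)]   and   [3 H = kappa (3 - 1/q)].
The linear algebra is [curvatures_of_rank_one_defect], the differential
geometry is [tube_curvatures], and each of the seven pairs of formulas is the
value of these two expressions.

On the analytic side, every field that occurs is a finite sum of terms
[c(t) d(w) V(s)]; this class is stable under the three partial derivatives, so
existence of the first and second partials reduces to one-variable calculus. *)

(** * The Lorentz product *)

Section lorentz_theory.
Context {R : realType}.
Implicit Types (x y z : 'rV[R]_4) (a : R).

Lemma lorentzC x y : lorentz x y = lorentz y x.
Proof. by rewrite /lorentz; ring. Qed.

Lemma lorentzDl x y z : lorentz (x + y) z = lorentz x z + lorentz y z.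
Proof. by rewrite /lorentz !mxE; ring. Qed.

Lemma lorentzZl a x z : lorentz (a *: x) z = a * lorentz x z.
Proof. by rewrite /lorentz !mxE; ring. Qed.

Lemma lorentzDr x y z : lorentz x (y + z) = lorentz x y + lorentz x z.
Proof. by rewrite lorentzC lorentzDl !(lorentzC x). Qed.

Lemma lorentzZr a x z : lorentz x (a *: z) = a * lorentz x z.
Proof. by rewrite lorentzC lorentzZl lorentzC. Qed.

Lemma lorentz0l x : lorentz 0 x = 0.
Proof. by rewrite /lorentz !mxE; ring. Qed.

Lemma lorentz_suml n (f : 'I_n -> 'rV[R]_4) y :
  lorentz (\sum_i f i) y = \sum_i lorentz (f i) y.
Proof.
elim/big_ind2 : _ => [|u a v b <- <-|//]; first exact: lorentz0l.
exact: lorentzDl.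
Qed.

(** The coordinates of the linear form [lorentz ^~ x]: with it, orthogonality to
[x] becomes a matrix equation. *)
Definition lower x : 'cV[R]_4 :=
  \col_i (if i == 0 then - x 0 i else x 0 i).

Lemma mulmx_lower n (A : 'M[R]_(n, 4)) x i :
  (A *m lower x) i 0 = lorentz (row i A) x.
Proof.
have sum4 (f : 'I_4 -> R) : \sum_i f i = f 0 + f 1 + f 2 + f 3.
  rewrite !big_ord_recl big_ord0 addr0 !addrA.
  by congr (f _ + f _ + f _ + f _); exact: val_inj.
by rewrite mxE sum4 /lorentz !mxE /= mulrN.
Qed.

(** Three vectors with invertible Gram matrix are independent; if they lie in the
hyperplane orthogonal to a non-null [U], they span it by dimension. *)
Lemma orthogonal_combination (A : 'M[R]_(3, 4)) (U T : 'rV[R]_4) :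
  \det (\matrix_(i, l) lorentz (row i A) (row l A)) != 0 ->
  lorentz U U != 0 -> (forall i, lorentz (row i A) U = 0) ->
  lorentz T U = 0 ->
  exists x : 'rV[R]_3, T = x *m A.
Proof.
move=> gA UU AU TU; suff /submxP[x ->] : (T <= A)%MS by exists x.
have Ak : (A <= kermx (lower U))%MS.
  by apply/sub_kermxP/matrixP => i k; rewrite [k]ord1 mulmx_lower AU mxE.
have Tk : (T <= kermx (lower U))%MS.
  apply/sub_kermxP/matrixP => i k; rewrite [k]ord1 mulmx_lower.
  by rewrite (_ : row i T = T) ?TU ?mxE//; apply/rowP => l; rewrite mxE ord1.
apply: submx_trans Tk _; rewrite -(mxrank_leqif_sup Ak) mxrank_ker.
have rU : (0 < \rank (lower U))%N.
  rewrite lt0n mxrank_eq0; apply: contra UU => /eqP U0.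
  have := mulmx_lower _ U U 0.
  rewrite U0 mulmx0 mxE (_ : row 0 U = U) => [<-//|].
  by apply/rowP => l; rewrite mxE.
have rA : \rank A = 3%N.
  apply/eqP; rewrite eqn_leq rank_leq_row/=.
  set g := (X in \det X) in gA.
  have gE : g = A *m \matrix_(k, l) lower (row l A) k 0.
    apply/matrixP => i l; rewrite mxE -mulmx_lower !mxE.
    by apply: eq_bigr => k _; rewrite !mxE.
  have /mxrank_unit rg : g \in unitmx by rewrite unitmxE unitfE.
  by rewrite -[leqLHS]rg gE mxrankM_maxl.
rewrite rA; have := rank_leq_col (lower U).
by case: (\rank _) rU => [|[|]].
Qed.

End lorentz_theory.

(** * Curvatures when the two forms differ by rank one *)

Section curvatures.
Context {R : realType}.

(** The matrix is upper triangular and only its first diagonal entry differs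
from 1. *)
Lemma det_sub_delta_row n (x : 'rV[R]_n.+1) :
  \det (1%:M - delta_mx 0 0 *m x) = 1 - x 0 0.
Proof.
rewrite -det_tr det_trig; last first.
  apply/is_trig_mxP => i l il; rewrite !mxE big_ord1 !mxE.
  have -> : (l == 0) = false by case: l il => [[|l] ?].
  by rewrite andbC mul0r subr0; case: eqP il => // ->; rewrite ltnn.
rewrite big_ord_recl big1 => [|i _]; rewrite !mxE big_ord1 !mxE eqxx ?mul1r ?mulr1//.
by rewrite mul0r subr0.
Qed.

(** The tangent space is the hyperplane orthogonal to [U], which contains [T];
write [T = x *m A] with [A] the matrix of the partial derivatives. Then
[x *m g] is the row of products [<T, G_l>], so the last hypothesis reads
[h = kappa (1 - e_0^T x) g]: the second form differs from a multiple of the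
first by a matrix of rank one. This matrix enters both curvatures through
[x_0] alone, which equals [1 / q] because [<T, T> = e]. *)
Lemma curvatures_of_rank_one_defect (G N : 'rV[R]_3 -> 'rV[R]_4) u
    (U T : 'rV[R]_4) (e kappa q : R) :
  regular_point G u ->
  lorentz U U != 0 -> lorentz T U = 0 -> e != 0 -> lorentz T T = e ->
  (forall i, lorentz (partial i G u) U = 0) ->
  (forall i, lorentz (partial i G u) T = (i == 0)%:R * (e * q)) ->
  (forall i l, second_form G N u i l =
     kappa * (first_form G u i l - (l == 0)%:R * lorentz (partial i G u) T)) ->
  [/\ q != 0, gauss_curvature G N u = kappa ^+ 3 * (1 - q^-1) &
      mean_curvature G N u = kappa * (1 - (3 * q)^-1)].
Proof.
move=> reg UU TU e0 TT GU GT hE.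
pose A : 'M[R]_(3, 4) := \matrix_i partial i G u.
have rowA i : row i A = partial i G u by rewrite rowK.
set g := first_form G u.
have gE : g = \matrix_(i, l) lorentz (row i A) (row l A).
  by apply/matrixP => i l; rewrite !mxE !rowA.
have gu : g \in unitmx by rewrite unitmxE unitfE.
have [x Tx] : exists x : 'rV[R]_3, T = x *m A.
  apply: (orthogonal_combination A U) => //; first by rewrite -gE.
  by move=> i; rewrite rowA.
have TxE y : lorentz T y = \sum_i x 0 i * lorentz (partial i G u) y.
  rewrite Tx mulmx_sum_row lorentz_suml.
  by apply: eq_bigr => i _; rewrite lorentzZl rowA.
have x0q : x 0 0 * q = 1.
  apply: (mulfI e0); rewrite mulr1 -[RHS]TT TxE (bigD1 0)//= big1 => [|i i0].
    by rewrite GT eqxx mul1r; ring.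
  by rewrite GT (negbTE i0) mul0r mulr0.
have q0 : q != 0.
  by apply/eqP => q0; move: x0q; rewrite q0 mulr0 => /esym/eqP; rewrite oner_eq0.
have x0E : x 0 0 = q^-1 by rewrite -[LHS](mulfK q0) x0q mul1r.
have xg l : (x *m g) 0 l = lorentz T (partial l G u).
  by rewrite TxE mxE; apply: eq_bigr => i _; rewrite mxE.
have hD : second_form G N u = kappa *: ((1%:M - delta_mx 0 0 *m x) *m g).
  apply/matrixP => i l; rewrite hE mulmxBl mul1mx -mulmxA.
  have -> (M M' : 'M[R]_3) : (kappa *: (M - M')) i l = kappa * (M i l - M' i l).
    by rewrite !mxE.
  rewrite (_ : (delta_mx 0 0 *m _) i l = (i == 0)%:R * lorentz T (partial l G u)).
    rewrite GT lorentzC GT.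
    by case: (i == 0); case: (l == 0); rewrite /= ?mulr1n ?mulr0n; ring.
  by rewrite mxE big_ord1 xg mxE eqxx andbT.
split=> //.
  rewrite /gauss_curvature -/g hD detZ det_mulmx det_sub_delta_row x0E.
  by rewrite mulrA mulfK.
rewrite /mean_curvature /shape_operator -/g hD -scalemxAr mxtraceZ.
rewrite mxtrace_mulC -mulmxA mulmxV// mulmx1 raddfB/= mxtrace1.
rewrite mxtrace_mulC trace_mx11 mxE (bigD1 0)//= big1 => [|i i0].
  by rewrite mxE eqxx mulr1 x0E addr0; field.
by rewrite mxE (negbTE i0) mulr0.
Qed.

End curvatures.

(** * Directional derivatives and smooth functions *)

Section calculus.
Context {R : realType}.

(** A directional derivative only sees the restriction to a line, so any function
of one variable that agrees with [f] on that line computes it. *)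
Lemma is_derive_line (V W : normedModType R) (f : V -> W) (g : R -> W)
    (u v : V) (x : R) (d : W) :
  (forall h, f (h *: v + u) = g (h + x)) -> is_derive x 1 g d ->
  is_derive u v f d.
Proof.
move=> fg [gx gd].
have E : (fun h => h^-1 *: ((f \o shift u) (h *: v) - f u)) =
         (fun h => h^-1 *: ((g \o shift x) (h *: 1) - g x)).
  apply/funext => h; rewrite /= fg [h *: 1]mulr1.
  by have := fg 0; rewrite scale0r !add0r => ->.
by split; rewrite /derivable /derive E.
Qed.

Lemma is_derive_scalel (V : normedModType R) (p : R -> R) (y : V) (x d : R) :
  is_derive x 1 p d -> is_derive x 1 (fun z => p z *: y) (d *: y).
Proof.
move=> [px pd].
have E : (fun h : R => h^-1 *: (((fun z => p z *: y) \o shift x) (h *: 1) - p x *: y)) =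
         (fun h : R => (h^-1 *: ((p \o shift x) (h *: 1) - p x)) *: y).
  by apply/funext => h /=; rewrite -scalerBl scalerA.
have C : h^-1 *: (((fun z => p z *: y) \o shift x) (h *: 1) - p x *: y)
    @[h --> 0^'] --> d *: y.
  by rewrite E; apply: cvgZr_tmp; rewrite -pd; exact: px.
by split; [apply: cvgP C|apply: cvg_lim C].
Qed.

Lemma is_derive_coord (V : normedModType R) m n (f : V -> 'M[R]_(m, n)) u v d i j :
  is_derive u v f d -> is_derive u v (fun z => f z i j) (d i j).
Proof.
move=> [fu fd].
have E : (fun h : R => h^-1 *: (((fun z => f z i j) \o shift u) (h *: v) - f u i j)) =
         (fun M : 'M[R]_(m, n) => M i j) \o
         (fun h : R => h^-1 *: ((f \o shift u) (h *: v) - f u)).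
  by apply/funext => h /=; rewrite !mxE.
have C : h^-1 *: (((fun z => f z i j) \o shift u) (h *: v) - f u i j)
    @[h --> 0^'] --> d i j.
  rewrite E; apply: continuous_cvg; first exact: coord_continuous.
  by rewrite -fd; exact: fu.
by split; [apply: cvgP C|apply: cvg_lim C].
Qed.

Lemma is_derive_lorentz (V : normedModType R) (f g : V -> 'rV[R]_4) u v df dg :
  is_derive u v f df -> is_derive u v g dg ->
  is_derive u v (fun z => lorentz (f z) (g z))
    (lorentz df (g u) + lorentz (f u) dg).
Proof.
move=> fu gu.
have fi := is_derive_coord _ _ _ _ _ _ _ 0 ^~ fu.
have gi := is_derive_coord _ _ _ _ _ _ _ 0 ^~ gu.
have M i := is_deriveM (fi i) (gi i).
have -> : (fun z => lorentz (f z) (g z)) =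
  - ((fun z => f z 0 0) * (fun z => g z 0 0)) +
  (fun z => f z 0 1) * (fun z => g z 0 1) +
  (fun z => f z 0 2) * (fun z => g z 0 2) +
  (fun z => f z 0 3) * (fun z => g z 0 3) by [].
apply: (is_derive_eq (is_deriveD (is_deriveD (is_deriveD (is_deriveN (M 0)) (M 1)) (M 2)) (M 3))).
by rewrite /lorentz /GRing.scale/=; ring.
Qed.

(** Differentiating a constant product moves the derivative from one factor to the
other. Applied to [<U, U>], [<U, T>] and [<G_i, N>], it replaces every product
that would require differentiating [U] along the curve or [G] twice. *)
Lemma lorentz_cst_derive (V : normedModType R) (f g : V -> 'rV[R]_4) u v df dg (c : R) :
  is_derive u v f df -> is_derive u v g dg ->
  (\forall z \near u, lorentz (f z) (g z) = c) ->
  lorentz df (g u) = - lorentz (f u) dg.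
Proof.
move=> fu gu fgc.
have [_ H] := is_derive_lorentz _ _ _ _ _ _ _ fu gu.
have : 'D_v (fun z => lorentz (f z) (g z)) u = 0.
  by rewrite (near_eq_derive v fgc) derive_val.
by rewrite H => /eqP; rewrite addr_eq0 => /eqP.
Qed.

Lemma smooth_on_is_derive (V : normedModType R) (I : set R) (f : R -> V) x :
  smooth_on I f -> I x -> is_derive x 1 f (derive1 f x).
Proof. by move=> fI Ix; split; [exact: (fI 0%N)|rewrite derive1E]. Qed.

Lemma smooth_on_derive1 (V : normedModType R) (I : set R) (f : R -> V) :
  smooth_on I f -> smooth_on I (derive1 f).
Proof. by move=> fI n x Ix; rewrite -derive1Sn; exact: fI. Qed.

(** A class of functions stable under differentiation consists of smooth functions.
It applies to constants and to the spans of [cos], [sin] and of [exp x],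
[exp (- x)]. *)
Lemma smooth_on_closed_class (P : (R -> R) -> Prop) (f : R -> R) :
  (forall g, P g -> exists2 g', P g' & forall x : R, is_derive x 1 g (g' x)) ->
  P f -> smooth_on setT f.
Proof.
move=> PP + n; elim: n f => [|n IHn] f Pf x _.
  by have [g' _ /(_ x)[]] := PP _ Pf.
have [g' Pg' fg'] := PP _ Pf.
rewrite derive1Sn (_ : derive1 f = g'); first exact: IHn.
by apply/funext => z; rewrite derive1E derive_val.
Qed.

Lemma smooth_cst (c : R) : smooth_on setT (cst c).
Proof.
apply: (smooth_on_closed_class (fun g => exists a, g = cst a)); last by exists c.
by move=> _ [a ->]; exists (cst 0) => [|x]; [exists 0|exact: is_derive_cst].
Qed.

Lemma smooth_trig (a b : R) : smooth_on setT (fun x => a * cos x + b * sin x).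
Proof.
apply: (smooth_on_closed_class
  (fun g => exists a b, g = fun x => a * cos x + b * sin x)); last by exists a, b.
move=> _ [c [d ->]].
exists (fun x => d * cos x + - c * sin x) => [|x]; first by exists d, (- c).
have -> : (fun x => c * cos x + d * sin x) = c \*: @cos R + d \*: @sin R by [].
apply: (is_derive_eq (is_deriveD (is_deriveZ _ (is_derive_cos x)) (is_deriveZ _ (is_derive_sin x)))).
by rewrite /GRing.scale/=; ring.
Qed.

Lemma is_derive_expRN (x : R) : is_derive x 1 (fun z => expR (- z)) (- expR (- x)).
Proof.
rewrite -mulrN1; apply: (is_derive1_comp (f := expR) (g := -%R)).
Qed.

Lemma smooth_hyp (a b : R) : smooth_on setT (fun x => a * expR x + b * expR (- x)).
Proof.
apply: (smooth_on_closed_class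
  (fun g => exists a b, g = fun x => a * expR x + b * expR (- x))); last by exists a, b.
move=> _ [c [d ->]].
exists (fun x => c * expR x + - d * expR (- x)) => [|x]; first by exists c, (- d).
have H := is_derive_expRN x.
have -> : (fun x => c * expR x + d * expR (- x)) =
  c \*: @expR R + d \*: (fun x => expR (- x)) by [].
apply: (is_derive_eq (is_deriveD (is_deriveZ _ (is_derive_expR x)) (is_deriveZ _ H))).
by rewrite /GRing.scale/=; ring.
Qed.

Lemma smooth_cos : smooth_on setT (@cos R).
Proof.
by have := smooth_trig 1 0; under eq_fun do rewrite mul1r mul0r addr0.
Qed.

Lemma smooth_sin : smooth_on setT (@sin R).
Proof.
by have := smooth_trig 0 1; under eq_fun do rewrite mul1r mul0r add0r.
Qed.

Lemma smooth_cosh : smooth_on setT (@cosh R).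
Proof.
rewrite (_ : @cosh R = fun x => 2^-1 * expR x + 2^-1 * expR (- x)).
  exact: smooth_hyp.
by apply/funext => x; rewrite /cosh; ring.
Qed.

Lemma smooth_sinh : smooth_on setT (@sinh R).
Proof.
rewrite (_ : @sinh R = fun x => 2^-1 * expR x + - 2^-1 * expR (- x)).
  exact: smooth_hyp.
by apply/funext => x; rewrite /sinh; ring.
Qed.

Lemma cosh2_sub_sinh2 (x : R) : cosh x ^+ 2 - sinh x ^+ 2 = 1.
Proof.
have : expR x * expR (- x) = 1 by rewrite expRN mulfV// gt_eqF// expR_gt0.
by rewrite /cosh /sinh => E; rewrite -[RHS]E; field.
Qed.

End calculus.

(** * Sums of fields with separated variables *)

Section separated_fields.
Context {R : realType}.

(** A triple [(V, c, d)] stands for the vector field [c(t) d(w) V(s)] along the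
parameter space; each partial derivative acts on one factor only, so it can be
computed on the triple. *)
Definition sepfield : Type := (R -> 'rV[R]_4) * (R -> R) * (R -> R).

Definition sep_val (x : sepfield) (u : 'rV[R]_3) : 'rV[R]_4 :=
  let: (V, c, d) := x in (c (u 0 1) * d (u 0 2)) *: V (u 0 0).

Definition sep_der (i : 'I_3) (x : sepfield) : sepfield :=
  let: (V, c, d) := x in
  match val i with
  | 0%N => (derive1 V, c, d)
  | 1%N => (V, derive1 c, d)
  | _ => (V, c, derive1 d)
  end.

Definition sep_smooth (I : set R) (x : sepfield) : Prop :=
  let: (V, c, d) := x in
  [/\ smooth_on I V, smooth_on setT c & smooth_on setT d].

Lemma sep_der_smooth I i x : sep_smooth I x -> sep_smooth I (sep_der i x).
Proof.
case: x => [[V c] d] [HV Hc Hd]; case: i => [[|[|i]] ?]; split.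
- exact: smooth_on_derive1 HV.
- exact: Hc.
- exact: Hd.
- exact: HV.
- exact: smooth_on_derive1 Hc.
- exact: Hd.
- exact: HV.
- exact: Hc.
- exact: smooth_on_derive1 Hd.
Qed.

Lemma sep_is_derive I i x (u : 'rV[R]_3) : sep_smooth I x -> I (u 0 0) ->
  is_derive u (delta_mx 0 i : 'rV[R]_3) (sep_val x) (sep_val (sep_der i x) u).
Proof.
case: x => [[V c] d] [HV Hc Hd] Iu.
have E k l h : (h *: (delta_mx 0 k : 'rV[R]_3) + u) 0 l = h * (l == k)%:R + u 0 l.
  by rewrite !mxE eqxx.
case: i => [[|[|[|//]]] i3]; rewrite /sep_der /=.
- apply: (is_derive_line _ _ _
    (fun z => (c (u 0 1) * d (u 0 2)) *: V z) _ _ (u 0 0)).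
    by move=> h /=; rewrite !E/= !mulr0 !add0r mulr1.
  exact: is_deriveZ (smooth_on_is_derive _ _ _ _ HV Iu).
- apply: (is_derive_line _ _ _
    (fun z => (c z * d (u 0 2)) *: V (u 0 0)) _ _ (u 0 1)).
    by move=> h /=; rewrite !E/= !mulr0 !add0r mulr1.
  apply: is_derive_scalel.
  under eq_fun do rewrite mulrC.
  rewrite mulrC.
  exact: (is_deriveZ _ (smooth_on_is_derive _ _ _ _ Hc _)).
- apply: (is_derive_line _ _ _
    (fun z => (c (u 0 1) * d z) *: V (u 0 0)) _ _ (u 0 2)).
    by move=> h /=; rewrite !E/= !mulr0 !add0r mulr1.
  apply: is_derive_scalel.
  exact: (is_deriveZ _ (smooth_on_is_derive _ _ _ _ Hd _)).
Qed.

Lemma is_derive_sep_sum I n (x : 'I_n -> sepfield) i (u : 'rV[R]_3) :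
  (forall m, sep_smooth I (x m)) -> I (u 0 0) ->
  is_derive u (delta_mx 0 i : 'rV[R]_3) (fun z => \sum_m sep_val (x m) z)
    (\sum_m sep_val (sep_der i (x m)) u).
Proof.
move=> sx Iu.
have -> : (fun z => \sum_m sep_val (x m) z) = \sum_m sep_val (x m).
  by apply/funext => z; rewrite fct_sumE.
by apply: is_derive_sum => m; exact: (sep_is_derive _ _ _ _ (sx m) Iu).
Qed.

Lemma near_coord (I : set R) (u : 'rV[R]_3) : open I -> I (u 0 0) ->
  nbhs u [set z : 'rV[R]_3 | I (z 0 0)].
Proof.
move=> oI Iu; apply: (@coord_continuous R 1 3 0 0 u).
exact: open_nbhs_nbhs.
Qed.

End separated_fields.

(** * Curvatures of a tube around a Frenet curve *)

(** The Weingarten relation, from differentiating [<G_i, N> = 0]: second derivatives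
of [G] need not be computed, only known to exist. *)
Lemma second_form_weingarten {R : realType} (G N : 'rV[R]_3 -> 'rV[R]_4) u i l
    (ddG dN : 'rV[R]_4) :
  is_derive u (delta_mx 0 l : 'rV[R]_3) (partial i G) ddG ->
  is_derive u (delta_mx 0 l : 'rV[R]_3) N dN ->
  (\forall z \near u, lorentz (partial i G z) (N z) = 0) ->
  second_form G N u i l = - lorentz (partial i G u) dN.
Proof.
move=> dG dN' GN; rewrite mxE /partial.
have [_ ->] := dG; exact: lorentz_cst_derive dG dN' GN.
Qed.

Section tube_curvatures.
Context {R : realType} {j : nat} {I : set R} {beta : R -> 'rV[R]_4}.
Context {F : nat -> R -> 'rV[R]_4} {k1 k2 k3 : R -> R}.
Hypothesis frenet : frenet_curve j I beta F k1 k2 k3.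
Hypothesis openI : open I.
Context (c d : 'I_3 -> R -> R).
Hypothesis smooth_c : forall m, smooth_on setT (c m).
Hypothesis smooth_d : forall m, smooth_on setT (d m).

(* The index [m = 0, 1, 2] stands for the frame vector [F_(m + 2)]. *)
Let X (m : 'I_3) : sepfield := (F m.+2, c m, d m).
Let U (u : 'rV[R]_3) : 'rV[R]_4 := \sum_m sep_val (X m) u.
Context (nu : R).
Hypothesis nu0 : nu != 0.
Hypothesis UU : forall u : 'rV[R]_3, I (u 0 0) -> lorentz (U u) (U u) = nu.

Context (r sigma : R).
Hypothesis r0 : r != 0.

Let G (u : 'rV[R]_3) : 'rV[R]_4 := beta (u 0 0) + r *: U u.
Let N (u : 'rV[R]_3) : 'rV[R]_4 := (- sigma) *: U u.

Let dU (i : 'I_3) (u : 'rV[R]_3) : 'rV[R]_4 := \sum_m sep_val (sep_der i (X m)) u.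

Let smooth_X m : sep_smooth I (X m).
Proof.
split; [|exact: smooth_c|exact: smooth_d].
by apply: (frenet_frame_smooth frenet); case: m => [[|[|[|]]]].
Qed.

Let is_derive_U i (u : 'rV[R]_3) : I (u 0 0) ->
  is_derive u (delta_mx 0 i : 'rV[R]_3) U (dU i u).
Proof. by move=> Iu; exact: (is_derive_sep_sum I _ _ _ _ smooth_X Iu). Qed.

Let is_derive_dU i l (u : 'rV[R]_3) : I (u 0 0) ->
  is_derive u (delta_mx 0 l : 'rV[R]_3) (dU i)
    (\sum_m sep_val (sep_der l (sep_der i (X m))) u).
Proof.
move=> Iu; apply: (is_derive_sep_sum I _ _ _ _ _ Iu) => m.
exact: sep_der_smooth (smooth_X m).
Qed.

Let is_derive_along (f : R -> 'rV[R]_4) i (u : 'rV[R]_3) :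
  smooth_on I f -> I (u 0 0) ->
  is_derive u (delta_mx 0 i : 'rV[R]_3) (fun z => f (z 0 0))
    ((i == 0)%:R *: derive1 f (u 0 0)).
Proof.
move=> sf Iu; have sx : sep_smooth I (f, cst 1, cst 1).
  by split; [exact: sf|exact: smooth_cst|exact: smooth_cst].
have := sep_is_derive _ i _ _ sx Iu.
have -> : sep_val (f, cst 1, cst 1) = fun z : 'rV[R]_3 => f (z 0 0).
  by apply/funext => z; rewrite /= mulr1 scale1r.
congr (is_derive _ _ _ _).
by case: i => [[|[|[|//]]] ?]; rewrite /= ?derive1_cst ?(mulr1, mulr0, mul0r)
  ?mulr1n ?mulr0n ?scale0r.
Qed.

Let partial_G i (u : 'rV[R]_3) : I (u 0 0) ->
  partial i G u = (i == 0)%:R *: F 1%N (u 0 0) + r *: dU i u.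
Proof.
move=> Iu; rewrite (frenet_tangent frenet)//.
have D := is_deriveD (is_derive_along _ i _ (frenet_beta_smooth frenet) Iu)
  (is_deriveZ r (is_derive_U i _ Iu)).
by have [_ <-] := D.
Qed.

Let is_derive_partial_G i l (u : 'rV[R]_3) : I (u 0 0) ->
  exists ddG, is_derive u (delta_mx 0 l : 'rV[R]_3) (partial i G) ddG.
Proof.
move=> Iu; eexists.
have sF1 : smooth_on I (F 1%N) by exact: (frenet_frame_smooth frenet).
have D := is_deriveD
  (is_deriveZ (i == 0)%:R (is_derive_along _ l _ sF1 Iu))
  (is_deriveZ r (is_derive_dU i l _ Iu)).
refine (near_eq_is_derive _ D).
apply: filterS (near_coord _ _ openI Iu) => z Iz.
by rewrite partial_G.
Qed.

Let F_U (l : nat) (u : 'rV[R]_3) : (1 <= l <= 2)%N -> I (u 0 0) ->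
  lorentz (F l (u 0 0)) (U u) =
  (l == 2)%:R * (eps R j 2 * (c 0 (u 0 1) * d 0 (u 0 2))).
Proof.
move=> l12 Iu; rewrite lorentzC lorentz_suml big_ord_recl big1 => [|m _].
  rewrite addr0 lorentzZl; case: l l12 => [|[|[|]]]//= _.
    by rewrite (frenet_orthogonal frenet)// mulr0 mul0r.
  by rewrite (frenet_norm frenet)// mul1r mulrC.
rewrite lorentzZl (frenet_orthogonal frenet) ?mulr0//.
- by case: m => [[|[|]]].
- by case: l l12 => [|[|[|]]].
- by case: l l12 => [|[|[|]]]//= _; rewrite eqE/= -lt0n.
Qed.

Let dU_U i (u : 'rV[R]_3) : I (u 0 0) -> lorentz (dU i u) (U u) = 0.
Proof.
move=> Iu; have D := is_derive_U i _ Iu.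
have : lorentz (dU i u) (U u) = - lorentz (U u) (dU i u).
  apply: (lorentz_cst_derive _ _ _ _ _ _ _ nu D D).
  by apply: filterS (near_coord _ _ openI Iu) => z; exact: UU.
by rewrite (lorentzC (U u)); lra.
Qed.

Let partial_G_U i (u : 'rV[R]_3) : I (u 0 0) -> lorentz (partial i G u) (U u) = 0.
Proof.
move=> Iu.
by rewrite partial_G// lorentzDl !lorentzZl dU_U// F_U// mul0r !mulr0 addr0.
Qed.

Let dU_F1 i (u : 'rV[R]_3) : I (u 0 0) ->
  lorentz (dU i u) (F 1%N (u 0 0)) =
  - ((i == 0)%:R * (k1 (u 0 0) * (eps R j 2 * (c 0 (u 0 1) * d 0 (u 0 2))))).
Proof.
move=> Iu; have D := is_derive_U i _ Iu.
have sF1 : smooth_on I (F 1%N) by exact: (frenet_frame_smooth frenet).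
have -> := lorentz_cst_derive _ _ _ _ _ _ _ 0 D (is_derive_along _ i _ sF1 Iu).
  rewrite (frenet_eq1 frenet)// lorentzC !lorentzZl F_U//.
  by rewrite mul1r.
apply: filterS (near_coord _ _ openI Iu) => z Iz.
by rewrite lorentzC F_U// mul0r.
Qed.

Let e := eps R j 1.
Let q (u : 'rV[R]_3) :=
  1 - e * (r * k1 (u 0 0) * (eps R j 2 * (c 0 (u 0 1) * d 0 (u 0 2)))).

Let eps_sq i : eps R j i * eps R j i = 1.
Proof. by rewrite /eps; case: ifP => _; ring. Qed.

(** Here [T] is the tangent [F_1] of the curve. Orthogonality of [U] to [F_1] and
the constancy of [<U, U>] give all the hypotheses of
[curvatures_of_rank_one_defect]; the curvature [k1] enters through
[<U_s, F_1> = - <U, F_1'>]. *)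
Lemma tube_curvatures (u : 'rV[R]_3) : I (u 0 0) -> regular_point G u ->
  [/\ q u != 0,
      gauss_curvature G N u = (sigma / r) ^+ 3 * (1 - (q u)^-1) &
      mean_curvature G N u = sigma / r * (1 - (3 * q u)^-1)].
Proof.
move=> Iu reg.
have e0 : e != 0.
  by apply/eqP => e0; have := eps_sq 1; rewrite -/e e0 mul0r => /esym/eqP;
     rewrite oner_eq0.
apply: (curvatures_of_rank_one_defect _ _ _ (U u) (F 1%N (u 0 0)) e _ _ reg) => //.
- by rewrite UU.
- by rewrite F_U// mul0r.
- exact: (frenet_norm frenet).
- by move=> i; exact: partial_G_U.
- move=> i; rewrite partial_G// lorentzDl !lorentzZl dU_F1//.
  rewrite (frenet_norm frenet)// -/e /q mulrBr [e * (e * _)]mulrA eps_sq.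
  by ring.
- move=> i l; have [ddG DG] := is_derive_partial_G i l _ Iu.
  rewrite (second_form_weingarten _ _ _ _ _ _ _ DG
    (is_deriveZ (- sigma) (is_derive_U l _ Iu))); last first.
    apply: filterS (near_coord _ _ openI Iu) => z Iz.
    by rewrite lorentzZr partial_G_U// mulr0.
  rewrite mxE (partial_G l)// lorentzDr !lorentzZr.
  by field.
Qed.

End tube_curvatures.

(** * The seven parametrizations *)

(** In each case the components of the direction separate into a function of [t]
times a function of [w], and they parametrize the points of square [lam] in
the space spanned by [F_2], [F_3], [F_4]. *)
Lemma tube_coef_factor {R : realType} j lam :
  (j, lam) \in [:: (1%N, 1); (2%N, 1); (2%N, -1); (3%N, 1); (3%N, -1);
                   (4%N, 1); (4%N, -1)] ->
  exists c d : 'I_3 -> R -> R,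
    [/\ forall m, smooth_on setT (c m), forall m, smooth_on setT (d m),
        forall t w, tube_coef j lam t w =
          (c 0 t * d 0 w, c 1 t * d 1 w, c 2 t * d 2 w) &
        forall t w, eps R j 2 * (c 0 t * d 0 w) ^+ 2 +
          eps R j 3 * (c 1 t * d 1 w) ^+ 2 +
          eps R j 4 * (c 2 t * d 2 w) ^+ 2 = lam%:~R].
Proof.
pose tri (f g h : R -> R) (m : 'I_3) := nth h [:: f; g] m.
have tri_smooth f g h : smooth_on setT f -> smooth_on setT g ->
    smooth_on setT h -> forall m, smooth_on setT (tri f g h m).
  by move=> sf sg sh [[|[|[|i]]] m3]; [exact: sf|exact: sg|exact: sh|].
have S1 := smooth_cst (1 : R).
have Sc := @smooth_cos R; have Ss := @smooth_sin R.
have Sch := @smooth_cosh R; have Ssh := @smooth_sinh R.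
have ch x : cosh x ^+ 2 = 1 + sinh x ^+ 2 :> R by have := cosh2_sub_sinh2 x; lra.
have co x : cos x ^+ 2 = 1 - sin x ^+ 2 :> R by have := cos2Dsin2 x; lra.
rewrite !inE => /orP[|/orP[|/orP[|/orP[|/orP[|/orP[|]]]]]] /eqP[-> ->].
- exists (tri cos sin (cst 1)), (tri cos cos sin).
  split=> [||t w|t w].
  - exact: (tri_smooth _ _ _ Sc Ss S1).
  - exact: (tri_smooth _ _ _ Sc Sc Ss).
  - by rewrite /tri/= ?mul1r ?mulr1.
  by rewrite /tri /eps /= !exprMn !co; ring.
- exists (tri (@cosh R) (cst 1) (@sinh R)), (tri (@sinh R) (@cosh R) (@sinh R)).
  split=> [||t w|t w].
  - exact: (tri_smooth _ _ _ Sch S1 Ssh).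
  - exact: (tri_smooth _ _ _ Ssh Sch Ssh).
  - by rewrite /tri/= ?mul1r ?mulr1.
  (* [exprMn] is given a factor because [cosh] itself unfolds to a product. *)
  by rewrite /tri /eps /= ?mul1r ?mulr1 ?(exprMn 2 (cosh _))
    ?(exprMn 2 (sinh _)) !ch; ring.
- exists (tri (@cosh R) (cst 1) (@sinh R)), (tri (@cosh R) (@sinh R) (@cosh R)).
  split=> [||t w|t w].
  - exact: (tri_smooth _ _ _ Sch S1 Ssh).
  - exact: (tri_smooth _ _ _ Sch Ssh Sch).
  - by rewrite /tri/= ?mul1r ?mulr1.
  by rewrite /tri /eps /= ?mul1r ?mulr1 ?(exprMn 2 (cosh _))
    ?(exprMn 2 (sinh _)) !ch; ring.
- exists (tri (@sinh R) (@cosh R) (cst 1)), (tri (@sinh R) (@sinh R) (@cosh R)).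
  split=> [||t w|t w].
  - exact: (tri_smooth _ _ _ Ssh Sch S1).
  - exact: (tri_smooth _ _ _ Ssh Ssh Sch).
  - by rewrite /tri/= ?mul1r ?mulr1.
  by rewrite /tri /eps /= ?mul1r ?mulr1 ?(exprMn 2 (cosh _))
    ?(exprMn 2 (sinh _)) !ch; ring.
- exists (tri (@sinh R) (@cosh R) (cst 1)), (tri (@cosh R) (@cosh R) (@sinh R)).
  split=> [||t w|t w].
  - exact: (tri_smooth _ _ _ Ssh Sch S1).
  - exact: (tri_smooth _ _ _ Sch Sch Ssh).
  - by rewrite /tri/= ?mul1r ?mulr1.
  by rewrite /tri /eps /= ?mul1r ?mulr1 ?(exprMn 2 (cosh _))
    ?(exprMn 2 (sinh _)) !ch; ring.
- exists (tri (cst 1) (@sinh R) (@cosh R)), (tri (@cosh R) (@sinh R) (@sinh R)).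
  split=> [||t w|t w].
  - exact: (tri_smooth _ _ _ S1 Ssh Sch).
  - exact: (tri_smooth _ _ _ Sch Ssh Ssh).
  - by rewrite /tri/= ?mul1r ?mulr1.
  by rewrite /tri /eps /= ?mul1r ?mulr1 ?(exprMn 2 (cosh _))
    ?(exprMn 2 (sinh _)) !ch; ring.
- exists (tri (cst 1) (@sinh R) (@cosh R)), (tri (@sinh R) (@cosh R) (@cosh R)).
  split=> [||t w|t w].
  - exact: (tri_smooth _ _ _ S1 Ssh Sch).
  - exact: (tri_smooth _ _ _ Ssh Sch Sch).
  - by rewrite /tri/= ?mul1r ?mulr1.
  by rewrite /tri /eps /= ?mul1r ?mulr1 ?(exprMn 2 (cosh _))
    ?(exprMn 2 (sinh _)) !ch; ring.
Qed.

(** The case analysis ends here: all seven tubes have the same curvatures in terms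
of the signs [eps] and of the component of the direction along [F_2]. *)
Lemma frenet_tube_curvatures {R : realType} (r : R) (j : nat) (lam : int)
    (I : set R) (beta : R -> 'rV[R]_4) (F : nat -> R -> 'rV[R]_4)
    (k1 k2 k3 : R -> R) (s t w : R) :
  r != 0 ->
  (j, lam) \in [:: (1%N, 1); (2%N, 1); (2%N, -1); (3%N, 1); (3%N, -1);
                   (4%N, 1); (4%N, -1)] ->
  open I -> frenet_curve j I beta F k1 k2 k3 -> I s ->
  let G := tube F j lam r beta in
  let N := tube_normal F j lam in
  let u := param s t w in
  let a := (tube_coef j lam t w).1.1 in
  let kappa := eps R j 3 * eps R j 4 * lam%:~R ^+ j / r in
  let q := 1 - eps R j 1 * (r * k1 s * (eps R j 2 * a)) in
  regular_point G u ->
  [/\ q != 0, gauss_curvature G N u = kappa ^+ 3 * (1 - q^-1) &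
      mean_curvature G N u = kappa * (1 - (3 * q)^-1)].
Proof.
move=> r0 jl oI fr Is G N u a kappa q reg.
have [c [d [sc sd cdE normE]]] := @tube_coef_factor R _ _ jl.
pose U (v : 'rV[R]_3) : 'rV[R]_4 := \sum_(m < 3) sep_val (F m.+2, c m, d m) v.
have dirE v : tube_dir F j lam v = U v.
  rewrite /tube_dir cdE /U !big_ord_recl big_ord0 addr0 addrA /=.
  have -> : lift ord0 ord0 = 1 :> 'I_3 by exact: val_inj.
  by have -> : lift ord0 (lift ord0 ord0) = 2 :> 'I_3 by exact: val_inj.
have UU (v : 'rV[R]_3) : I (v 0 0) -> lorentz (U v) (U v) = lam%:~R.
  move=> Iv; rewrite -dirE /tube_dir cdE.
  rewrite !(lorentzDl, lorentzDr, lorentzZl, lorentzZr).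
  rewrite !(frenet_norm fr)// !(frenet_orthogonal fr)//.
  by rewrite -(normE (v 0 1) (v 0 2)); ring.
have GE : G = fun v => beta (v 0 0) + r *: U v.
  by apply/funext => v; rewrite /G /tube dirE.
have NE : N = fun v => (- (eps R j 3 * eps R j 4 * lam%:~R ^+ j)) *: U v.
  by apply/funext => v; rewrite /N /tube_normal dirE.
have u0 : u 0 0 = s by rewrite mxE.
have Iu : I (u 0 0) by rewrite u0.
have nu0 : lam%:~R != 0 :> R.
  rewrite intr_eq0; move: jl; rewrite !inE.
  by do 6?[case/orP => [/eqP[_ ->]//|]]; case/eqP => _ ->.
rewrite GE in reg *; rewrite NE.
have := tube_curvatures fr oI c d sc sd _ nu0 UU _ _ r0 u Iu reg.
by rewrite u0 /q /a cdE !mxE.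
Qed.

Theorem theorem10 (R : realType) (r : R) (j : nat) (lam : int) (I : set R)
    (beta : R -> 'rV[R]_4) (F : nat -> R -> 'rV[R]_4) (k1 k2 k3 : R -> R)
    (s t w : R) :
  0 < r ->
  (j, lam) \in [:: (1%N, 1); (2%N, 1); (2%N, -1); (3%N, 1); (3%N, -1);
                   (4%N, 1); (4%N, -1)] ->
  open I -> is_interval I ->
  frenet_curve j I beta F k1 k2 k3 ->
  I s ->
  regular_point (tube F j lam r beta) (param s t w) ->
  let K := gauss_curvature (tube F j lam r beta) (tube_normal F j lam)
             (param s t w) in
  let H := mean_curvature (tube F j lam r beta) (tube_normal F j lam)
             (param s t w) in
  ((j, lam) = (1%N, 1) ->
     K = (k1 s * cos t * cos w) / (r ^+ 2 * (1 + r * k1 s * cos t * cos w)) /\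
     H = (2 + 3 * r * k1 s * cos t * cos w)
         / (3 * r * (1 + r * k1 s * cos t * cos w))) /\
  ((j, lam) = (2%N, 1) ->
     K = (k1 s * cosh t * sinh w)
         / (r ^+ 2 * (1 + r * k1 s * cosh t * sinh w)) /\
     H = (2 + 3 * r * k1 s * cosh t * sinh w)
         / (3 * r * (1 + r * k1 s * cosh t * sinh w))) /\
  ((j, lam) = (2%N, -1) ->
     K = (k1 s * cosh t * cosh w)
         / (r ^+ 2 * (1 + r * k1 s * cosh t * cosh w)) /\
     H = (2 + 3 * r * k1 s * cosh t * cosh w)
         / (3 * r * (1 + r * k1 s * cosh t * cosh w))) /\
  ((j, lam) = (3%N, 1) ->
     K = (k1 s * sinh t * sinh w)
         / (r ^+ 2 * (1 - r * k1 s * sinh t * sinh w)) /\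
     H = (2 - 3 * r * k1 s * sinh t * sinh w)
         / (3 * r * (-1 + r * k1 s * sinh t * sinh w))) /\
  ((j, lam) = (3%N, -1) ->
     K = (k1 s * sinh t * cosh w)
         / (r ^+ 2 * (-1 + r * k1 s * sinh t * cosh w)) /\
     H = (2 - 3 * r * k1 s * sinh t * cosh w)
         / (3 * r * (1 - r * k1 s * sinh t * cosh w))) /\
  ((j, lam) = (4%N, 1) ->
     K = (k1 s * cosh w) / (r ^+ 2 * (1 - r * k1 s * cosh w)) /\
     H = (2 - 3 * r * k1 s * cosh w) / (3 * r * (-1 + r * k1 s * cosh w))) /\
  ((j, lam) = (4%N, -1) ->
     K = (k1 s * sinh w) / (r ^+ 2 * (1 - r * k1 s * sinh w)) /\
     H = (2 - 3 * r * k1 s * sinh w) / (3 * r * (-1 + r * k1 s * sinh w))).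
Proof.
move=> r0 jl oI _ fr Is reg K H.
have rn0 : r != 0 by rewrite gt_eqF.
have [] := frenet_tube_curvatures _ _ _ _ _ _ _ _ _ _ t w rn0 jl oI fr Is reg.
rewrite -/K -/H => q0 -> ->.
(* [field] asks for the denominators to be nonzero: these are [r] and, up to
   sign, [q] with the numerical values of the signs [eps] put in. *)
split; [|split; [|split; [|split; [|split; [|split]]]]] => -[jE lE];
  move: q0; rewrite jE lE /eps /= => q0; split; field;
  do ?[apply/andP; split]; first [exact: rn0 |
    by apply: contraNneq q0 => den0; apply/eqP; move: den0; lra].
Qed.
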